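(* Let $\kappa,\tau\ge 0$ be given real numbers such that if $\kappa=0$ then $\tau=0$. Put $\chi^2=\kappa^2+\tau^2+1$ and $$\omega_1=\sqrt{\frac{\chi^2-\sqrt{\chi^4-4\tau^2}}{2}},\qquad \omega_2=\sqrt{\frac{\chi^2+\sqrt{\chi^4-4\tau^2}}{2}} .$$ Then: (1) There exists a helix $\boldsymbol{\gamma}:\mathbb{R}\to\mathbb{S}^3$ with constant curvature $\kappa$ and constant torsion $\tau$. Moreover, for every helix $\boldsymbol{\gamma}:\mathbb{R}\to\mathbb{S}^3$ with constant curvature $\kappa$ and constant torsion $\tau$, the following hold. (2)–(3) $\boldsymbol{\gamma}$ is a Lissajous curve whose fundamental angular frequencies are the numbers $\omega_1,\omega_2$ above, and these are distinct; that is, $\omega_2>\omega_1\ge 0$ and there are vectors $\mathbf{A}_1,\mathbf{B}_1,\mathbf{A}_2,\mathbf{B}_2\in\mathbb{R}^4$ such that for all $t\in\mathbb{R}$ $$\boldsymbol{\gamma}(t)=\cos(\omega_1 t)\mathbf{A}_1+\sin(\omega_1 t)\mathbf{B}_1+\cos(\omega_2 t)\mathbf{A}_2+\sin(\omega_2 t)\mathbf{B}_2 .$$ (4) If $\kappa>0$, then $\omega_2>1>\omega_1$. (5) If $\tau\neq 0$, then the four coefficient vectors $\mathbf{A}_1,\mathbf{B}_1,\mathbf{A}_2,\mathbf{B}_2$ in this representation are mutually orthogonal in $\mathbb{R}^4$, and $$|\mathbf{A}_1|^2=|\mathbf{B}_1|^2=\frac{1-\omega_2^2}{\omega_1^2-\omega_2^2},\qquad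 |\mathbf{A}_2|^2=|\mathbf{B}_2|^2=\frac{1-\omega_1^2}{\omega_2^2-\omega_1^2}.$$ (6) If $\tau=0$, then $\boldsymbol{\gamma}$ is a circle given by $$\boldsymbol{\gamma}(t)=\mathbf{A}_1+\cos(\omega t)\mathbf{A}_2+\sin(\omega t)\mathbf{B}_2,\qquad \omega=\sqrt{\kappa^2+1},$$ where $\mathbf{A}_1,\mathbf{A}_2,\mathbf{B}_2\in\mathbb{R}^4$ are mutually orthogonal, $|\mathbf{A}_2|=|\mathbf{B}_2|=\frac1\omega$ and $|\mathbf{A}_1|=\sqrt{1-\frac{1}{\omega^2}}$.
   Context: $\mathbb{S}^3=\{x\in\mathbb{R}^4: x_1^2+x_2^2+x_3^2+x_4^2=1\}$ carries the Riemannian metric induced from Euclidean $\mathbb{R}^4$; curves in $\mathbb{S}^3$ are regarded as $\mathbb{R}^4$-valued functions. Curvature and torsion (non-oriented convention). Let $M$ be a Riemannian 3-manifold, $I\subseteq\mathbb{R}$ an open interval, $\boldsymbol{\gamma}:I\to M$ a smooth curve parametrized by arc length $t$, $\mathbf{T}=\boldsymbol{\gamma}'$, and let $\frac{D}{dt}$ be covariant differentiation along $\boldsymbol{\gamma}$. The curvature is $\kappa(t)=\left|\frac{D}{dt}\mathbf{T}(t)\right|$. It is assumed that $\kappa$ is either nowhere zero or identically zero. If $\kappa$ is nowhere zero, put $\mathbf{N}=\frac1\kappa\frac{D}{dt}\mathbf{T}$ and define the torsion by $\tau(t)=\left|\frac{D}{dt}\mathbf{N}(t)+\kappa(t)\mathbf{T}(t)\right|\ge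 0$; it is assumed that $\tau$ is either nowhere zero or identically zero. If $\kappa\equiv 0$, the torsion is by definition $\tau\equiv 0$. A helix in $M$ is such a (smooth, arc-length parametrized) curve whose curvature $\kappa$ and torsion $\tau$ are (non-negative) constants. A smooth curve $\boldsymbol{\gamma}$ in $\mathbb{R}^4$ is a Lissajous curve if there are numbers $\omega_2>\omega_1\ge 0$ and vectors $\mathbf{A}_1,\mathbf{B}_1,\mathbf{A}_2,\mathbf{B}_2\in\mathbb{R}^4$ such that $\boldsymbol{\gamma}(t)=\cos(\omega_1 t)\mathbf{A}_1+\sin(\omega_1 t)\mathbf{B}_1+\cos(\omega_2 t)\mathbf{A}_2+\sin(\omega_2 t)\mathbf{B}_2$ for each $t$; $\omega_1,\omega_2$ are called its fundamental angular frequencies and $\mathbf{A}_1,\mathbf{B}_1,\mathbf{A}_2,\mathbf{B}_2$ its coefficient vectors. ''Orthogonal'' for a family of vectors means pairwise zero inner products (zero vectors allowed). *)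

(* Defs.v *)
From mathcomp Require Import all_boot all_order all_algebra.
From mathcomp Require Import all_classical all_reals all_analysis.
Import Order.TTheory GRing.Theory Num.Theory numFieldNormedType.Exports.

Set Implicit Arguments.
Unset Strict Implicit.
Unset Printing Implicit Defensive.

Local Open Scope classical_set_scope.
Local Open Scope ring_scope.

Section Helix.
Context {R : realType}.
Implicit Types (u v p : 'rV[R]_4) (gamma X : R -> 'rV[R]_4).

Definition dotp u v : R := \sum_(i < 4) u 0 i * v 0 i.

(* The norm [`|u|] of the library on row vectors is the sup norm. *)
Definition enorm u : R := Num.sqrt (dotp u u).

(* Zero vectors are allowed. *)
Definition mutually_orthogonal (s : seq 'rV[R]_4) : bool :=
  pairwise (fun u v => dotp u v == 0) s.

Definition S3 : set 'rV[R]_4 := [set p | dotp p p = 1].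

Definition smooth gamma : Prop :=
  forall n t, derivable (derive1n n gamma) t 1.

(* Orthogonal projection of R^4 onto T_p S^3, which is the orthogonal
   complement of p when p is in S^3. *)
Definition tangent_proj p v : 'rV[R]_4 := v - dotp v p *: p.

(* Covariant derivative D/dt, along gamma, of a vector field X tangent to S^3:
   the Levi-Civita connection of the induced metric is the tangential part of
   the derivative in R^4. *)
Definition covariant gamma X (t : R) : 'rV[R]_4 :=
  tangent_proj (gamma t) (derive1 X t).

Definition curvature gamma (t : R) : R := enorm (covariant gamma (derive1 gamma) t).

Definition principal_normal gamma (t : R) : 'rV[R]_4 :=
  (curvature gamma t)^-1 *: covariant gamma (derive1 gamma) t.

(* Non-oriented torsion, which is 0 by convention when the curvature vanishes
   identically. Only meaningful when the curvature is either nowhere zero or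
   identically zero, see [regular_curve]. *)
Definition torsion gamma (t : R) : R :=
  if `[< forall s, curvature gamma s = 0 >] then 0
  else enorm (covariant gamma (principal_normal gamma) t
              + curvature gamma t *: derive1 gamma t).

Definition nowhere_or_identically_zero (f : R -> R) : Prop :=
  (forall t, f t != 0) \/ (forall t, f t = 0).

(* Smooth arc-length parametrized curves R -> S^3 whose curvature and torsion
   are well defined. *)
Definition regular_curve gamma : Prop :=
  [/\ forall t, S3 (gamma t),
      smooth gamma,
      forall t, enorm (derive1 gamma t) = 1,
      nowhere_or_identically_zero (curvature gamma)
    & nowhere_or_identically_zero (torsion gamma)].

Definition helix (kappa tau : R) gamma : Prop :=
  [/\ regular_curve gamma,
      forall t, curvature gamma t = kappa
    & forall t, torsion gamma t = tau].

Definition lissajous (w1 w2 : R) (A1 B1 A2 B2 : 'rV[R]_4) gamma : Prop :=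
  forall t, gamma t = cos (w1 * t) *: A1 + sin (w1 * t) *: B1
                    + cos (w2 * t) *: A2 + sin (w2 * t) *: B2.

(* [chi2] is chi^2, so that chi^4 is [chi2 kappa tau ^+ 2]. *)
Definition chi2 (kappa tau : R) : R := kappa ^+ 2 + tau ^+ 2 + 1.

Definition omega1 (kappa tau : R) : R :=
  Num.sqrt ((chi2 kappa tau
             - Num.sqrt (chi2 kappa tau ^+ 2 - 4 * tau ^+ 2)) / 2).

Definition omega2 (kappa tau : R) : R :=
  Num.sqrt ((chi2 kappa tau
             + Num.sqrt (chi2 kappa tau ^+ 2 - 4 * tau ^+ 2)) / 2).

End Helix.

(* Main.v *)
Require Import Defs.
From mathcomp Require Import all_boot all_order all_algebra.
From mathcomp Require Import all_classical all_reals all_analysis.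
From mathcomp Require Import ring lra.
Import Order.TTheory GRing.Theory Num.Theory numFieldNormedType.Exports.

Set Implicit Arguments.
Unset Strict Implicit.
Unset Printing Implicit Defensive.

Local Open Scope classical_set_scope.
Local Open Scope ring_scope.

(* For a curve of constant curvature and torsion the Gram matrix of
   gamma, gamma', gamma'', gamma''' is constant. When tau <> 0 these vectors
   span R^4, which forces
     gamma'''' + chi^2 gamma'' + tau^2 gamma = 0,
   that is (D^2 + w1^2)(D^2 + w2^2) gamma = 0, since w1^2 + w2^2 = chi^2 and
   w1^2 w2^2 = tau^2; each of the two factors leaves a harmonic oscillator.
   The coefficient vectors are combinations of these vectors at time 0, so
   their inner products are read off the Gram matrix. When tau = 0 the equation
   degenerates to gamma''' + (kappa^2 + 1) gamma' = 0. Conversely, a Lissajous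
   curve along an orthonormal basis, with the amplitudes dictated by (5), is a
   helix, because (1 - w1^2)(w2^2 - 1) = kappa^2. *)

(** * Euclidean inner product on R^4 *)

Section DotProduct.
Context {R : realType}.
Implicit Types (u v w : 'rV[R]_4) (a : R).

Lemma dotpC u v : dotp u v = dotp v u.
Proof. by apply: eq_bigr => i _; rewrite mulrC. Qed.

Lemma dotpDl u v w : dotp (u + v) w = dotp u w + dotp v w.
Proof. by rewrite -big_split; apply: eq_bigr => i _; rewrite mxE mulrDl. Qed.

Lemma dotpZl a u v : dotp (a *: u) v = a * dotp u v.
Proof. by rewrite mulr_sumr; apply: eq_bigr => i _; rewrite mxE mulrA. Qed.

Lemma dotpDr u v w : dotp w (u + v) = dotp w u + dotp w v.
Proof. by rewrite dotpC dotpDl !(dotpC w). Qed.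

Lemma dotpZr a u v : dotp u (a *: v) = a * dotp u v.
Proof. by rewrite dotpC dotpZl dotpC. Qed.

Lemma dotpNl u v : dotp (- u) v = - dotp u v.
Proof. by rewrite -scaleN1r dotpZl mulN1r. Qed.

Lemma dotpNr u v : dotp u (- v) = - dotp u v.
Proof. by rewrite dotpC dotpNl dotpC. Qed.

Lemma dotp0r u : dotp u 0 = 0.
Proof. by rewrite -(scale0r 0) dotpZr mul0r. Qed.

Definition dotpE := (dotpDl, dotpDr, dotpNl, dotpNr, dotpZl, dotpZr).

Lemma dotp_ge0 u : 0 <= dotp u u.
Proof. by apply: sumr_ge0 => i _; rewrite -expr2 sqr_ge0. Qed.

Lemma dotp_eq0 u : dotp u u = 0 -> u = 0.
Proof.
move=> /eqP; rewrite psumr_eq0 => [/allP h|i _]; last by rewrite -expr2 sqr_ge0.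
apply/rowP => i; rewrite mxE.
by have /h := mem_index_enum i; rewrite mulf_eq0 orbb => /eqP.
Qed.

Lemma enorm_sqr u : enorm u ^+ 2 = dotp u u.
Proof. by rewrite sqr_sqrtr // dotp_ge0. Qed.

Lemma enorm_eqP u a : 0 <= a -> enorm u = a <-> dotp u u = a ^+ 2.
Proof.
move=> a0; split=> [<-|h]; first by rewrite enorm_sqr.
by rewrite /enorm h sqrtr_sqr ger0_norm.
Qed.

(** If [M] has rows [e i], then [M *m M^T] is diagonal with nonzero entries, so [M^T] is invertible,
    while the hypothesis on [v] reads [v *m M^T = 0]. *)
Lemma dotp_orthogonal_basis_eq0 (e : 'I_4 -> 'rV[R]_4) v :
  (forall i j, i != j -> dotp (e i) (e j) = 0) ->
  (forall i, dotp (e i) (e i) != 0) ->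
  (forall i, dotp v (e i) = 0) -> v = 0.
Proof.
move=> eo en ve.
pose M : 'M[R]_4 := \matrix_(i, j) e i 0 j.
have MM : M *m M^T = diag_mx (\row_i dotp (e i) (e i)).
  apply/matrixP => i j; rewrite !mxE.
  rewrite (_ : \sum_k _ = dotp (e i) (e j)); last first.
    by apply: eq_bigr => k _; rewrite !mxE.
  by case: eqVneq => [->|ij]; rewrite ?mulr1n // mulr0n eo.
have uM : M^T \in unitmx.
  suff : M *m M^T \in unitmx by rewrite unitmx_mul => /andP[].
  by rewrite unitmxE MM det_diag unitfE; apply/prodf_neq0 => i _; rewrite mxE.
rewrite -(mulmxK uM v) (_ : v *m M^T = 0) ?mul0mx //.
apply/rowP => i; rewrite !mxE -[RHS](ve i).
by apply: eq_bigr => k _; rewrite !mxE.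
Qed.

End DotProduct.

(** * Derivatives of curves in R^4 and the harmonic oscillator *)

Section VectorCalculus.
Context {R : realType}.
Implicit Types (X Y : R -> 'rV[R]_4) (t : R).

Lemma is_derive_rowP X t (D : 'rV[R]_4) :
  is_derive t 1 X D <-> forall i, is_derive t 1 (fun s => X s 0 i) (D 0 i).
Proof.
split=> [[dX <-] i|dX].
  have dXi := (derivable_mxP X t 1).1 dX ord0 i.
  by apply: DeriveDef => //; rewrite derive_mx // mxE.
have dX' : derivable X t 1.
  apply/derivable_mxP => i j; rewrite (ord1 i).
  by have [] := dX j.
apply: DeriveDef => //; rewrite derive_mx //; apply/rowP => i.
by rewrite mxE; have [_ ->] := dX i.
Qed.

Lemma is_derive_dotp X Y t (X' Y' : 'rV[R]_4) :
  is_derive t 1 X X' -> is_derive t 1 Y Y' ->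
  is_derive t 1 (fun s => dotp (X s) (Y s)) (dotp X' (Y t) + dotp (X t) Y').
Proof.
move=> /is_derive_rowP dX /is_derive_rowP dY.
have := @is_derive_sum _ _ _ 4 (fun i s => X s 0 i * Y s 0 i) t 1
  (fun i => X t 0 i *: Y' 0 i + Y t 0 i *: X' 0 i)
  (fun i => is_deriveM (dX i) (dY i)).
rewrite (_ : \sum_(i < 4) (fun s : R => _) = (fun s => dotp (X s) (Y s))); last first.
  by apply/funext => s; rewrite fct_sumE.
move=> h; apply: is_derive_eq; rewrite addrC -big_split /=.
by apply: eq_bigr => i _; rewrite [X' 0 i * _]mulrC.
Qed.

(** By the product rule, a constant inner product lets a derivative pass from one factor to the
    other with a change of sign. Each new Gram entry is obtained from earlier ones in this way. *)
Lemma derive_dotp_cst X Y t (X' Y' : 'rV[R]_4) (c : R) :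
  is_derive t 1 X X' -> is_derive t 1 Y Y' ->
  (forall s, dotp (X s) (Y s) = c) -> dotp X' (Y t) = - dotp (X t) Y'.
Proof.
move=> dX dY XYc; have [_] := is_derive_dotp dX dY.
rewrite (_ : (fun s => _) = cst c); last by apply/funext => s; rewrite XYc.
by rewrite derive_cst => /esym/eqP; rewrite addr_eq0 => /eqP.
Qed.

Lemma derive_dotp_self_cst X t (X' : 'rV[R]_4) (c : R) :
  is_derive t 1 X X' -> (forall s, dotp (X s) (X s) = c) -> dotp (X t) X' = 0.
Proof.
move=> dX XXc; have := derive_dotp_cst dX dX XXc; rewrite dotpC => /eqP.
by rewrite -addr_eq0 -mulr2n mulrn_eq0 => /eqP.
Qed.

Lemma is_derive_scalel (f : R -> R) t (f' : R) (A : 'rV[R]_4) :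
  is_derive t 1 f f' -> is_derive t 1 (fun s => f s *: A) (f' *: A).
Proof.
move=> df; apply/is_derive_rowP => i.
rewrite (_ : (fun s => _) = A 0 i \*: f); last first.
  by apply/funext => s; rewrite mxE mulrC.
by apply: is_derive_eq; rewrite mxE mulrC.
Qed.

Lemma is_derive_row0_cst X t : (forall s : R, is_derive s 1 X 0) -> X t = X 0.
Proof.
move=> dX; apply/rowP => i.
apply: (@is_derive_0_is_cst _ (fun s => X s 0 i)) => s.
by have /is_derive_rowP/(_ i) := dX s; rewrite mxE.
Qed.

Lemma is_derive_cosM (w t : R) :
  is_derive t 1 (fun s => cos (w * s)) (- (w * sin (w * t))).
Proof.
have h : is_derive t 1 (fun s => w * s) w.
  by apply: (is_derive_eq (is_deriveZ _ _)); rewrite /GRing.scale /= mulr1.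
by apply: (is_derive_eq (is_derive1_comp _ h)); rewrite /GRing.scale /= mulNr mulrC.
Qed.

Lemma is_derive_sinM (w t : R) :
  is_derive t 1 (fun s => sin (w * s)) (w * cos (w * t)).
Proof.
have h : is_derive t 1 (fun s => w * s) w.
  by apply: (is_derive_eq (is_deriveZ _ _)); rewrite /GRing.scale /= mulr1.
by apply: (is_derive_eq (is_derive1_comp _ h)); rewrite /GRing.scale /= mulrC.
Qed.

(* The conserved quantities are the position and velocity at time 0 of the
   solution, recovered by running the harmonic flow backwards. *)
Lemma harmonic_scalar (w : R) (x x' : R -> R) t : w != 0 ->
  (forall s : R, is_derive s 1 x (x' s)) ->
  (forall s : R, is_derive s 1 x' (- (w ^+ 2 * x s))) ->
  x t = cos (w * t) * x 0 + sin (w * t) * (w^-1 * x' 0).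
Proof.
move=> w0 dx dx'.
pose P s := cos (w * s) * x s - w^-1 * (sin (w * s) * x' s).
pose Q s := sin (w * s) * x s + w^-1 * (cos (w * s) * x' s).
have dc s := is_derive_cosM w s; have ds s := is_derive_sinM w s.
have PE : P t = P 0.
  apply: is_derive_0_is_cst => s.
  apply: (is_derive_eq (is_deriveB (is_deriveM (dc s) (dx s))
    (is_deriveZ _ (is_deriveM (ds s) (dx' s))))).
  by rewrite /GRing.scale /=; field.
have QE : Q t = Q 0.
  apply: is_derive_0_is_cst => s.
  apply: (is_derive_eq (is_deriveD (is_deriveM (ds s) (dx s))
    (is_deriveZ _ (is_deriveM (dc s) (dx' s))))).
  by rewrite /GRing.scale /=; field.
have -> : x t = cos (w * t) * P t + sin (w * t) * Q t.
  rewrite /P /Q -[LHS]mul1r -(cos2Dsin2 (w * t)); ring.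
by rewrite PE QE /P /Q mulr0 cos0 sin0; ring.
Qed.

Lemma harmonic_row (w : R) X (X' : R -> 'rV[R]_4) t : w != 0 ->
  (forall s : R, is_derive s 1 X (X' s)) ->
  (forall s : R, is_derive s 1 X' (- (w ^+ 2 *: X s))) ->
  X t = cos (w * t) *: X 0 + sin (w * t) *: (w^-1 *: X' 0).
Proof.
move=> w0 dX dX'; apply/rowP => i; rewrite !mxE.
apply: (@harmonic_scalar w (fun s => X s 0 i) (fun s => X' s 0 i)) => // s.
  by have /is_derive_rowP := dX s.
by have /is_derive_rowP/(_ i) := dX' s; rewrite !mxE.
Qed.

End VectorCalculus.

(* The vectors [X0], [X1], [X2 + X0] and [X3 + (kappa^2 + 1) X1] are the Frenet
   frame up to scaling, and the left-hand side is orthogonal to them all. *)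
Lemma gram_ode4 (R : realType) (kappa tau : R) (X0 X1 X2 X3 X4 : R -> 'rV[R]_4) :
  kappa != 0 -> tau != 0 ->
  (forall t : R, is_derive t 1 X0 (X1 t)) ->
  (forall t : R, is_derive t 1 X1 (X2 t)) ->
  (forall t : R, is_derive t 1 X2 (X3 t)) ->
  (forall t : R, is_derive t 1 X3 (X4 t)) ->
  (forall t, dotp (X0 t) (X0 t) = 1) ->
  (forall t, dotp (X0 t) (X1 t) = 0) ->
  (forall t, dotp (X0 t) (X2 t) = -1) ->
  (forall t, dotp (X0 t) (X3 t) = 0) ->
  (forall t, dotp (X1 t) (X1 t) = 1) ->
  (forall t, dotp (X1 t) (X2 t) = 0) ->
  (forall t, dotp (X1 t) (X3 t) = - (kappa ^+ 2 + 1)) ->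
  (forall t, dotp (X2 t) (X2 t) = kappa ^+ 2 + 1) ->
  (forall t, dotp (X2 t) (X3 t) = 0) ->
  (forall t, dotp (X3 t) (X3 t) = (kappa * tau) ^+ 2 + (kappa ^+ 2 + 1) ^+ 2) ->
  forall t, X4 t + chi2 kappa tau *: X2 t + tau ^+ 2 *: X0 t = 0.
Proof.
move=> k0 t0 d0 d1 d2 d3 G00 G01 G02 G03 G11 G12 G13 G22 G23 G33 t.
have G34 := derive_dotp_self_cst (d3 t) G33.
(* The products with [X4] come from differentiating the constant products with [X3]. *)
have G04 : dotp (X0 t) (X4 t) = kappa ^+ 2 + 1.
  by rewrite -[LHS]opprK -(derive_dotp_cst (d0 t) (d3 t) G03) G13 opprK.
have G14 : dotp (X1 t) (X4 t) = 0.
  by rewrite -[LHS]opprK -(derive_dotp_cst (d1 t) (d3 t) G13) G23 oppr0.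
have G24 : dotp (X2 t) (X4 t) = - ((kappa * tau) ^+ 2 + (kappa ^+ 2 + 1) ^+ 2).
  by rewrite -[LHS]opprK -(derive_dotp_cst (d2 t) (d3 t) G23) G33.
(* These rewrites put the lower order of differentiation first, the only order tabulated in [GE]. *)
have GC := (dotpC (X4 t), dotpC (X3 t) (X0 t), dotpC (X3 t) (X1 t),
  dotpC (X3 t) (X2 t), dotpC (X2 t) (X0 t), dotpC (X2 t) (X1 t),
  dotpC (X1 t) (X0 t)).
have GE := (G00, G01, G02, G03, G04, G11, G12, G13, G14, G22, G23, G24, G33, G34).
pose e (i : 'I_4) :=
  nth 0 [:: X0 t; X1 t; X2 t + X0 t; X3 t + (kappa ^+ 2 + 1) *: X1 t] i.
apply: (@dotp_orthogonal_basis_eq0 _ e).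
- move=> [[|[|[|[|//]]]] ?] [[|[|[|[|//]]]] ?] //= _;
    by rewrite /e /= ?dotpE ?GC ?GE; ring.
(* The squared lengths are 1, 1, kappa^2 and (kappa tau)^2; this is where both constants must be
   nonzero. *)
- move=> [[|[|[|[|//]]]] ?]; rewrite /e /= ?dotpE ?GC ?GE ?oner_eq0 //.
  + by rewrite [X in X != 0](_ : _ = kappa ^+ 2) ?expf_neq0 //; ring.
  + rewrite [X in X != 0](_ : _ = (kappa * tau) ^+ 2); last by ring.
    by rewrite expf_neq0 // mulf_neq0.
- move=> [[|[|[|[|//]]]] ?];
    by rewrite /e /= ?dotpE ?GC ?GE /chi2; ring.
Qed.

(** * Gram matrix and differential equations of a unit-speed curve in the sphere *)

Section UnitSpeedSphericalCurve.
Context {R : realType} (gamma : R -> 'rV[R]_4).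
Context (gamma_S3 : forall t, S3 (gamma t)) (gamma_smooth : smooth gamma).
Context (gamma_unit : forall t, enorm (derive1 gamma t) = 1).

Let g n : R -> 'rV[R]_4 := derive1n n gamma.

Lemma is_derive_derive1n n (t : R) : is_derive t 1 (g n) (g n.+1 t).
Proof. by rewrite /g derive1nS derive1E; apply: derivableP; exact: gamma_smooth. Qed.
Let dg := is_derive_derive1n.

Lemma dotp_position t : dotp (g 0 t) (g 0 t) = 1.
Proof. exact: gamma_S3. Qed.

Lemma dotp_velocity t : dotp (g 1 t) (g 1 t) = 1.
Proof. by have /(enorm_eqP _ ler01).1 := gamma_unit t; rewrite expr1n. Qed.

Lemma dotp_position_velocity t : dotp (g 0 t) (g 1 t) = 0.
Proof. exact: derive_dotp_self_cst (dg 0 t) dotp_position. Qed.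

Lemma dotp_position_acceleration t : dotp (g 0 t) (g 2 t) = -1.
Proof.
rewrite -[LHS]opprK -(derive_dotp_cst (dg 0 t) (dg 1 t)
  dotp_position_velocity).
by rewrite dotp_velocity ?oppr0.
Qed.

Lemma dotp_velocity_acceleration t : dotp (g 1 t) (g 2 t) = 0.
Proof. exact: derive_dotp_self_cst (dg 1 t) dotp_velocity. Qed.

(** Since the acceleration has inner product -1 with the position, removing its radial part amounts
    to adding [gamma t]. *)
Lemma covariant_velocity t :
  covariant gamma (derive1 gamma) t = g 2 t + gamma t.
Proof.
rewrite /covariant /tangent_proj -/(g 1) -[derive1 (g 1) t]/(g 2 t).
by rewrite (dotpC (g 2 t)) dotp_position_acceleration scaleN1r opprK.
Qed.

Lemma dotp_position_jerk t : dotp (g 0 t) (g 3 t) = 0.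
Proof.
rewrite -[LHS]opprK -(derive_dotp_cst (dg 0 t) (dg 2 t)
  dotp_position_acceleration).
by rewrite dotp_velocity_acceleration ?oppr0.
Qed.

Section ConstantCurvature.
Context (kappa : R) (gamma_curvature : forall t, curvature gamma t = kappa).

Let kappa_ge0 : 0 <= kappa.
Proof. by rewrite -(gamma_curvature 0) sqrtr_ge0. Qed.

Lemma dotp_acceleration t : dotp (g 2 t) (g 2 t) = kappa ^+ 2 + 1.
Proof.
(* Expanding |gamma'' + gamma|^2 = kappa^2 gives |gamma''|^2 - 2 + 1 = kappa^2. *)
have := gamma_curvature t; rewrite /curvature covariant_velocity.
move/(enorm_eqP _ kappa_ge0).1 => <-.
rewrite -/(g 0) !dotpE dotp_position (dotpC (g 2 t) (g 0 t)).
rewrite dotp_position_acceleration; ring.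
Qed.

Lemma dotp_velocity_jerk t : dotp (g 1 t) (g 3 t) = - (kappa ^+ 2 + 1).
Proof.
rewrite -[LHS]opprK -(derive_dotp_cst (dg 1 t) (dg 2 t)
  dotp_velocity_acceleration).
by rewrite dotp_acceleration ?oppr0.
Qed.

Lemma dotp_acceleration_jerk t : dotp (g 2 t) (g 3 t) = 0.
Proof. exact: derive_dotp_self_cst (dg 2 t) dotp_acceleration. Qed.

(* In terms of the Frenet frame, [binormal t] is [kappa * tau] times the
   binormal vector. *)
Definition binormal t : 'rV[R]_4 := g 3 t + (kappa ^+ 2 + 1) *: g 1 t.

(** Here N = (gamma'' + gamma) / kappa, and N' = (gamma''' + gamma') / kappa is already tangent
    because both terms are orthogonal to gamma. Adding kappa gamma' yields the binormal term divided
    by kappa. *)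
Lemma torsion_pos_curvature t : 0 < kappa ->
  torsion gamma t = enorm (kappa^-1 *: binormal t).
Proof.
move=> k0; rewrite /torsion asboolF; last first.
  by move=> /(_ 0); rewrite gamma_curvature => /eqP; rewrite gt_eqF.
rewrite gamma_curvature; congr enorm.
rewrite /covariant.
have -> : principal_normal gamma = kappa^-1 \*: (g 2 + g 0).
  by apply/funext => s; rewrite /principal_normal gamma_curvature covariant_velocity.
rewrite derive1E.
have [_ ->] := is_deriveZ kappa^-1 (is_deriveD (dg 2 t) (dg 0 t)).
rewrite /tangent_proj -/(g 0) !dotpE (dotpC (g 3 t)) (dotpC (g 1 t)).
rewrite dotp_position_jerk dotp_position_velocity addr0 mulr0 scale0r subr0.
rewrite -[derive1 gamma t]/(g 1 t) /binormal.
by apply/rowP => i; rewrite !mxE; field; rewrite gt_eqF.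
Qed.

(** The squared length of gamma'' + gamma is (kappa^2 + 1) - 2 + 1 = kappa^2, which vanishes: the
    curve is a geodesic. *)
Lemma zero_curvature t : kappa = 0 -> g 2 t = - g 0 t.
Proof.
move=> k0; apply/eqP; rewrite -addr_eq0; apply/eqP/dotp_eq0.
rewrite !dotpE (dotpC (g 2 t) (g 0 t)) dotp_position dotp_acceleration.
by rewrite dotp_position_acceleration k0; ring.
Qed.

Lemma zero_curvature_binormal t : kappa = 0 -> binormal t = 0.
Proof.
move=> k0; have h2 : g 2 = - g 0 by apply/funext => s; exact: zero_curvature.
have h3 : g 3 t = - g 1 t.
  rewrite /g derive1nS -/(g 2) h2 derive1E.
  by have [_ ->] := is_deriveN (dg 0 t).
by rewrite /binormal h3 k0 expr0n add0r scale1r addNr.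
Qed.

Section ConstantTorsion.
Context (tau : R) (kappa0_tau0 : kappa = 0 -> tau = 0).
Context (gamma_torsion : forall t, torsion gamma t = tau).

Lemma dotp_binormal t : dotp (binormal t) (binormal t) = (kappa * tau) ^+ 2.
Proof.
have tau0 : 0 <= tau.
  by rewrite -(gamma_torsion 0) /torsion; case: ifP => // _; rewrite sqrtr_ge0.
(* For zero curvature the torsion is set by convention and carries no information on gamma''', so
   the binormal is shown to vanish directly. *)
have [k0|k0] := eqVneq kappa 0.
  by rewrite zero_curvature_binormal // dotp0r k0 mul0r expr0n.
have := gamma_torsion t.
rewrite torsion_pos_curvature ?lt_def ?k0 // => /(enorm_eqP _ tau0).1.
by rewrite dotpZl dotpZr mulrA exprMn => <-; move: (dotp _ _) => b; field.
Qed.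

Lemma dotp_jerk t :
  dotp (g 3 t) (g 3 t) = (kappa * tau) ^+ 2 + (kappa ^+ 2 + 1) ^+ 2.
Proof.
rewrite -(dotp_binormal t) /binormal !dotpE (dotpC (g 3 t) (g 1 t)).
by rewrite dotp_velocity_jerk dotp_velocity; ring.
Qed.

(** The equation says that [binormal] is zero, and its length is kappa tau. *)
Lemma helix_ode3 t : tau = 0 -> g 3 t = - ((kappa ^+ 2 + 1) *: g 1 t).
Proof.
move=> t0; apply/eqP; rewrite -addr_eq0; apply/eqP/dotp_eq0.
by rewrite [LHS]dotp_binormal t0 mulr0 expr0n.
Qed.

Lemma helix_ode4 t : tau != 0 ->
  g 4 t + chi2 kappa tau *: g 2 t + tau ^+ 2 *: g 0 t = 0.
Proof.
move=> tau0; have kappa0 : kappa != 0 by apply: contra_neq tau0.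
exact: (gram_ode4 kappa0 tau0 (dg 0) (dg 1) (dg 2) (dg 3)
  dotp_position dotp_position_velocity dotp_position_acceleration
  dotp_position_jerk dotp_velocity dotp_velocity_acceleration
  dotp_velocity_jerk dotp_acceleration dotp_acceleration_jerk dotp_jerk).
Qed.

End ConstantTorsion.
End ConstantCurvature.
End UnitSpeedSphericalCurve.

(** * Algebraic relations between the frequencies, the curvature and the torsion *)

Section AngularFrequencies.
Context {R : realType} (kappa tau : R).
Context (kappa0_tau0 : kappa = 0 -> tau = 0).
Local Notation w1 := (omega1 kappa tau).
Local Notation w2 := (omega2 kappa tau).
Local Notation chi := (chi2 kappa tau).

Let discr_gt0 : 0 < chi ^+ 2 - 4 * tau ^+ 2.
Proof.
(* The factors are chi^2 + 2 tau and chi^2 - 2 tau, up to order. The product vanishes only for kappa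
   = 0 and tau = 1 or -1, which [kappa0_tau0] excludes. *)
have -> : chi ^+ 2 - 4 * tau ^+ 2 =
    (kappa ^+ 2 + (tau - 1) ^+ 2) * (kappa ^+ 2 + (tau + 1) ^+ 2).
  by rewrite /chi2; ring.
have [k0|k0] := eqVneq kappa 0.
  by rewrite kappa0_tau0 // k0; lra.
have : 0 < kappa ^+ 2 by rewrite exprn_even_gt0.
by move=> ?; rewrite mulr_gt0 // ltr_wpDr // sqr_ge0.
Qed.

Let chi_gt0 : 0 < chi.
Proof. by rewrite ltr_wpDl // addr_ge0 ?sqr_ge0. Qed.

Let root := Num.sqrt (chi ^+ 2 - 4 * tau ^+ 2).

Let root_gt0 : 0 < root. Proof. by rewrite sqrtr_gt0. Qed.

Let root_sqr : root ^+ 2 = chi ^+ 2 - 4 * tau ^+ 2.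
Proof. by rewrite sqr_sqrtr // ltW. Qed.

Let root_le_chi : root <= chi.
Proof.
rewrite -(@ler_pXn2r _ 2) ?nnegrE ?(ltW chi_gt0) ?(ltW root_gt0) //.
by rewrite root_sqr; have := sqr_ge0 tau; lra.
Qed.

Let omega1_sqr : w1 ^+ 2 = (chi - root) / 2.
Proof. by rewrite sqr_sqrtr // divr_ge0 // subr_ge0. Qed.

Let omega2_sqr : w2 ^+ 2 = (chi + root) / 2.
Proof. by rewrite sqr_sqrtr // divr_ge0 // addr_ge0 // ltW. Qed.

Lemma omega1_ge0 : 0 <= w1. Proof. exact: sqrtr_ge0. Qed.

Lemma omega_sqr_lt : w1 ^+ 2 < w2 ^+ 2.
Proof. by rewrite omega1_sqr omega2_sqr; have := root_gt0; lra. Qed.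

Lemma omega_lt : w1 < w2.
Proof. by rewrite -(@ltr_pXn2r _ 2) ?nnegrE ?sqrtr_ge0 // omega_sqr_lt. Qed.

Lemma omega2_gt0 : 0 < w2. Proof. exact: le_lt_trans omega1_ge0 omega_lt. Qed.

Lemma omega_sqrD : w1 ^+ 2 + w2 ^+ 2 = chi.
Proof. by rewrite omega1_sqr omega2_sqr; field. Qed.

Lemma omega_sqrM : w1 ^+ 2 * w2 ^+ 2 = tau ^+ 2.
Proof.
by apply: (@mulfI _ 4) => //; rewrite omega1_sqr omega2_sqr;
  have := root_sqr; lra.
Qed.

(** The product expands to (w1^2 + w2^2) - 1 - w1^2 w2^2 = chi^2 - 1 - tau^2. *)
Lemma omega_kappa : (1 - w1 ^+ 2) * (w2 ^+ 2 - 1) = kappa ^+ 2.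
Proof. by have := omega_sqrD; have := omega_sqrM; rewrite /chi2; lra. Qed.

(** The numbers 1 - w1^2 and w2^2 - 1 have nonnegative product and positive sum, so neither is
    negative. *)
Lemma omega_straddle1 : w1 ^+ 2 <= 1 <= w2 ^+ 2.
Proof.
have := omega_kappa; have := omega_sqr_lt; have := sqr_ge0 kappa; nra.
Qed.

Lemma omega_straddle1_strict : 0 < kappa -> w1 < 1 /\ 1 < w2.
Proof.
move=> k0; have k2 : 0 < kappa ^+ 2 by rewrite exprn_gt0.
have [h1 h2] := andP omega_straddle1; have h := omega_kappa.
split; rewrite -(@ltr_pXn2r _ 2) ?nnegrE ?sqrtr_ge0 // expr1n.
  rewrite lt_neqAle h1 andbT; apply/eqP => e.
  by move: h; rewrite e; lra.
rewrite lt_neqAle h2 andbT; apply/eqP => e.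
by move: h; rewrite -e; lra.
Qed.

Lemma omega1_neq0 : tau != 0 -> w1 != 0.
Proof.
move=> t0; apply: contra_neq t0 => e; apply/eqP.
by rewrite -(sqrf_eq0 tau) -omega_sqrM e expr0n mul0r.
Qed.

Lemma omega1_tau0 : tau = 0 -> w1 = 0.
Proof.
move=> t0; have t2 : tau ^+ 2 = 0 by rewrite t0 expr0n.
apply/eqP; rewrite -(sqrf_eq0 w1).
have /eqP := omega_sqrM; rewrite t2 mulf_eq0 (sqrf_eq0 w2).
by rewrite (gt_eqF omega2_gt0) orbF.
Qed.

Lemma omega2_tau0 : tau = 0 -> w2 = Num.sqrt (kappa ^+ 2 + 1).
Proof.
move=> t0; have t2 : tau ^+ 2 = 0 by rewrite t0 expr0n.
have := omega_sqrD; rewrite omega1_tau0 // expr0n add0r /chi2 t2 addr0.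
by move=> <-; rewrite sqrtr_sqr ger0_norm // ltW // omega2_gt0.
Qed.

End AngularFrequencies.

(** * Lissajous curves as a family closed under linear combination and differentiation *)

Section LissajousCurves.
Context {R : realType} (w1 w2 : R).
Implicit Types A B C D : 'rV[R]_4.

Definition lissajous_curve A B C D (t : R) : 'rV[R]_4 :=
  cos (w1 * t) *: A + sin (w1 * t) *: B + cos (w2 * t) *: C + sin (w2 * t) *: D.

Lemma lissajous_curve0 A B C D : lissajous_curve A B C D 0 = A + C.
Proof. by rewrite /lissajous_curve !mulr0 cos0 sin0 !scale1r !scale0r !addr0. Qed.

Lemma lissajous_curveD A B C D A' B' C' D' t :
  lissajous_curve A B C D t + lissajous_curve A' B' C' D' t =
  lissajous_curve (A + A') (B + B') (C + C') (D + D') t.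
Proof. by apply/rowP => i; rewrite !mxE; ring. Qed.

Lemma lissajous_curveZ (c : R) A B C D t :
  c *: lissajous_curve A B C D t =
  lissajous_curve (c *: A) (c *: B) (c *: C) (c *: D) t.
Proof. by apply/rowP => i; rewrite !mxE; ring. Qed.

(** Orthogonality removes the cross terms and cos^2 + sin^2 = 1 removes [t]. In the existence proof
    this one formula gives the radius, speed, curvature and torsion. *)
Lemma dotp_lissajous_curve A B C D t :
  dotp A B = 0 -> dotp A C = 0 -> dotp A D = 0 ->
  dotp B C = 0 -> dotp B D = 0 -> dotp C D = 0 ->
  dotp B B = dotp A A -> dotp D D = dotp C C ->
  dotp (lissajous_curve A B C D t) (lissajous_curve A B C D t) =
  dotp A A + dotp C C.
Proof.
move=> AB AC AD BC BD CD BB DD.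
have -> : dotp A A + dotp C C =
    (cos (w1 * t) ^+ 2 + sin (w1 * t) ^+ 2) * dotp A A +
    (cos (w2 * t) ^+ 2 + sin (w2 * t) ^+ 2) * dotp C C.
  by rewrite !cos2Dsin2 !mul1r.
rewrite !dotpE (dotpC B A) (dotpC C A) (dotpC D A) (dotpC C B) (dotpC D B).
by rewrite (dotpC D C) AB AC AD BC BD CD BB DD; ring.
Qed.

Lemma is_derive_lissajous_curve A B C D (t : R) :
  is_derive t 1 (lissajous_curve A B C D)
    (lissajous_curve (w1 *: B) (- (w1 *: A)) (w2 *: D) (- (w2 *: C)) t).
Proof.
have dc w := is_derive_cosM w t; have ds w := is_derive_sinM w t.
apply: (is_derive_eq (is_deriveD (is_deriveD (is_deriveD
  (is_derive_scalel A (dc w1)) (is_derive_scalel B (ds w1)))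
  (is_derive_scalel C (dc w2))) (is_derive_scalel D (ds w2)))).
by apply/rowP => i; rewrite !mxE; ring.
Qed.

Lemma derive1_lissajous_curve A B C D :
  derive1 (lissajous_curve A B C D) =
  lissajous_curve (w1 *: B) (- (w1 *: A)) (w2 *: D) (- (w2 *: C)).
Proof.
apply/funext => t; rewrite derive1E.
by have [_ ->] := is_derive_lissajous_curve A B C D t.
Qed.

Lemma smooth_lissajous_curve A B C D : smooth (lissajous_curve A B C D).
Proof.
move=> n t.
suff [A' [B' [C' [D' ->]]]] : exists A' B' C' D',
    derive1n n (lissajous_curve A B C D) = lissajous_curve A' B' C' D'.
  by have [] := is_derive_lissajous_curve A' B' C' D' t.
elim: n => [|n [A' [B' [C' [D' IH]]]]]; first by exists A, B, C, D.
rewrite derive1nS IH derive1_lissajous_curve.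
by do 4!eexists.
Qed.

End LissajousCurves.

(** * Existence of a helix with given curvature and torsion *)

Lemma dotp_delta (R : realType) (i j : 'I_4) :
  dotp (delta_mx 0 i : 'rV[R]_4) (delta_mx 0 j) = (i == j)%:R.
Proof.
rewrite /dotp (bigD1 i) //= big1 => [|k ki]; last first.
  by rewrite !mxE (negPf ki) mul0r.
by rewrite !mxE !eqxx mul1r addr0.
Qed.

Lemma lissajous_helix (R : realType) (kappa tau w1 w2 : R) :
  0 <= kappa -> 0 <= tau -> (kappa = 0 -> tau = 0) ->
  w1 ^+ 2 < w2 ^+ 2 -> w1 ^+ 2 <= 1 <= w2 ^+ 2 ->
  w1 ^+ 2 * w2 ^+ 2 = tau ^+ 2 -> (1 - w1 ^+ 2) * (w2 ^+ 2 - 1) = kappa ^+ 2 ->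
  exists gamma : R -> 'rV[R]_4, helix kappa tau gamma.
Proof.
move=> kappa_ge0 tau_ge0 kappa0_tau0 w12 /andP[w1_le1 w2_ge1] wtau wkappa.
have d_gt0 : 0 < w2 ^+ 2 - w1 ^+ 2 by rewrite subr_gt0.
have d0 : w2 ^+ 2 - w1 ^+ 2 != 0 by rewrite gt_eqF.
(* The amplitudes solve a^2 + b^2 = 1 (the curve lies in the sphere) and w1^2 a^2 + w2^2 b^2 = 1 (it
   has unit speed). *)
pose a := Num.sqrt ((w2 ^+ 2 - 1) / (w2 ^+ 2 - w1 ^+ 2)).
pose b := Num.sqrt ((1 - w1 ^+ 2) / (w2 ^+ 2 - w1 ^+ 2)).
have a2 : a ^+ 2 = (w2 ^+ 2 - 1) / (w2 ^+ 2 - w1 ^+ 2).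
  by rewrite sqr_sqrtr // divr_ge0 ?subr_ge0 // ltW.
have b2 : b ^+ 2 = (1 - w1 ^+ 2) / (w2 ^+ 2 - w1 ^+ 2).
  by rewrite sqr_sqrtr // divr_ge0 ?subr_ge0 // ltW.
clearbody a b.
pose E (i : 'I_4) : 'rV[R]_4 := delta_mx 0 i.
have EE i j : dotp (E i) (E j) = (i == j)%:R by exact: dotp_delta.
clearbody E.
pose E0 := E (@Ordinal 4 0 isT); pose E1 := E (@Ordinal 4 1 isT).
pose E2 := E (@Ordinal 4 2 isT); pose E3 := E (@Ordinal 4 3 isT).
pose L := @lissajous_curve R w1 w2.
pose gamma := L (a *: E0) (a *: E1) (b *: E2) (b *: E3).
have smooth_gamma : smooth gamma by exact: smooth_lissajous_curve.
have g1 : derive1n 1 gamma = L (w1 *: (a *: E1)) (- (w1 *: (a *: E0)))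
    (w2 *: (b *: E3)) (- (w2 *: (b *: E2))).
  by rewrite derive1n1 derive1_lissajous_curve.
have g2 : derive1n 2 gamma = L (w1 *: - (w1 *: (a *: E0))) (- (w1 *: (w1 *: (a *: E1))))
    (w2 *: - (w2 *: (b *: E2))) (- (w2 *: (w2 *: (b *: E3)))).
  by rewrite derive1nS g1 derive1_lissajous_curve.
have g3 : derive1n 3 gamma =
    L (w1 *: - (w1 *: (w1 *: (a *: E1)))) (- (w1 *: (w1 *: - (w1 *: (a *: E0)))))
      (w2 *: - (w2 *: (w2 *: (b *: E3)))) (- (w2 *: (w2 *: - (w2 *: (b *: E2))))).
  by rewrite derive1nS g2 derive1_lissajous_curve.
have S3_gamma t : S3 (gamma t).
  rewrite /S3 /= dotp_lissajous_curve !dotpE !EE /=; try ring.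
  rewrite [LHS](_ : _ = a ^+ 2 + b ^+ 2); last by ring.
  by rewrite a2 b2; field.
have unit_gamma t : enorm (derive1 gamma t) = 1.
  apply/(enorm_eqP _ ler01); rewrite -derive1n1 g1 expr1n.
  rewrite dotp_lissajous_curve !dotpE !EE /=; try ring.
  rewrite [LHS](_ : _ = w1 ^+ 2 * a ^+ 2 + w2 ^+ 2 * b ^+ 2); last by ring.
  by rewrite a2 b2; field.
have curvature_gamma t : curvature gamma t = kappa.
  apply/(enorm_eqP _ kappa_ge0); rewrite covariant_velocity // g2 lissajous_curveD.
  rewrite dotp_lissajous_curve !dotpE !EE /=; try ring.
  rewrite [LHS](_ : _ = (1 - w1 ^+ 2) ^+ 2 * a ^+ 2 + (1 - w2 ^+ 2) ^+ 2 * b ^+ 2);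
    last by ring.
  by rewrite a2 b2 -wkappa; field.
have torsion_gamma t : torsion gamma t = tau.
  have [k0|k0] := eqVneq kappa 0.
    (* The convention for vanishing curvature gives torsion 0, and tau = 0 by hypothesis. *)
    rewrite /torsion asboolT ?kappa0_tau0 // => s.
    by rewrite curvature_gamma.
  rewrite (torsion_pos_curvature _ _ _ curvature_gamma) ?lt_def ?k0 //.
  apply/(enorm_eqP _ tau_ge0); rewrite /binormal g1 g3 !lissajous_curveZ.
  rewrite lissajous_curveD lissajous_curveZ.
  rewrite dotp_lissajous_curve !dotpE !EE /=; try ring.
  have k20 : kappa ^+ 2 != 0 by rewrite expf_neq0.
  (* Multiplying by kappa^2 clears the factor kappa^-2; what remains is a rational identity in w1
     and w2. *)
  apply: (mulfI k20).
  rewrite [LHS](_ : _ = w1 ^+ 2 * (kappa ^+ 2 + 1 - w1 ^+ 2) ^+ 2 * a ^+ 2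
    + w2 ^+ 2 * (kappa ^+ 2 + 1 - w2 ^+ 2) ^+ 2 * b ^+ 2); last by field.
  by rewrite a2 b2 -wkappa -wtau; field.
have dichotomy (f : R -> R) c : (forall t, f t = c) -> nowhere_or_identically_zero f.
  move=> fc; have [c0|c0] := eqVneq c 0; [right|left] => t; rewrite fc //.
exists gamma; split=> //; split=> //; exact: dichotomy.
Qed.

(** * Inner products of the coefficient vectors *)

(** The vectors [G0] to [G3] are position, velocity, acceleration and jerk at time 0, with [t2],
    [k2] standing for tau^2, kappa^2. The even orders determine [A1], [A2] and the odd ones [B1],
    [B2], so the Gram matrix fixes all their inner products. *)
Lemma lissajous_coefficients (R : realType) (w1 w2 t2 k2 : R)
    (G0 G1 G2 G3 A1 B1 A2 B2 : 'rV[R]_4) :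
  w1 != 0 -> w2 != 0 -> w2 ^+ 2 - w1 ^+ 2 != 0 ->
  w1 ^+ 2 * w2 ^+ 2 = t2 -> (1 - w1 ^+ 2) * (w2 ^+ 2 - 1) = k2 ->
  dotp G0 G0 = 1 -> dotp G0 G1 = 0 -> dotp G0 G2 = -1 -> dotp G0 G3 = 0 ->
  dotp G1 G1 = 1 -> dotp G1 G2 = 0 -> dotp G1 G3 = - (k2 + 1) ->
  dotp G2 G2 = k2 + 1 -> dotp G2 G3 = 0 ->
  dotp G3 G3 = k2 * t2 + (k2 + 1) ^+ 2 ->
  G0 = A1 + A2 -> G1 = w1 *: B1 + w2 *: B2 ->
  G2 = - (w1 ^+ 2 *: A1 + w2 ^+ 2 *: A2) ->
  G3 = - (w1 ^+ 3 *: B1 + w2 ^+ 3 *: B2) ->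
  [/\ mutually_orthogonal [:: A1; B1; A2; B2],
      enorm A1 ^+ 2 = (1 - w2 ^+ 2) / (w1 ^+ 2 - w2 ^+ 2),
      enorm B1 ^+ 2 = (1 - w2 ^+ 2) / (w1 ^+ 2 - w2 ^+ 2),
      enorm A2 ^+ 2 = (1 - w1 ^+ 2) / (w2 ^+ 2 - w1 ^+ 2)
    & enorm B2 ^+ 2 = (1 - w1 ^+ 2) / (w2 ^+ 2 - w1 ^+ 2)].
Proof.
move=> w10 w20 d0 <- <- G00 G01 G02 G03 G11 G12 G13 G22 G23 G33 e0 e1 e2 e3.
have d0' : w1 ^+ 2 - w2 ^+ 2 != 0 by rewrite -opprB oppr_eq0.
(* Adding w2^2 times the order two below eliminates the vectors of frequency w2, and adding w1^2
   times it eliminates those of frequency w1. *)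
have -> : A1 = (w2 ^+ 2 - w1 ^+ 2)^-1 *: (G2 + w2 ^+ 2 *: G0).
  by rewrite e0 e2; apply/rowP => i; rewrite !mxE; field.
have -> : A2 = (w1 ^+ 2 - w2 ^+ 2)^-1 *: (G2 + w1 ^+ 2 *: G0).
  by rewrite e0 e2; apply/rowP => i; rewrite !mxE; field.
have -> : B1 = (w1 * (w2 ^+ 2 - w1 ^+ 2))^-1 *: (G3 + w2 ^+ 2 *: G1).
  by rewrite e1 e3; apply/rowP => i; rewrite !mxE; field; rewrite d0 w10.
have -> : B2 = (w2 * (w1 ^+ 2 - w2 ^+ 2))^-1 *: (G3 + w1 ^+ 2 *: G1).
  by rewrite e1 e3; apply/rowP => i; rewrite !mxE; field; rewrite d0' w20.
have GC := (dotpC G3 G0, dotpC G3 G1, dotpC G3 G2, dotpC G2 G0, dotpC G2 G1,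
  dotpC G1 G0).
have GE := (G00, G01, G02, G03, G11, G12, G13, G22, G23, G33).
move=> {e0 e1 e2 e3}.
split; rewrite ?enorm_sqr.
2-5: by rewrite !dotpE !GC !GE; field; rewrite ?w10 ?w20 ?d0 ?d0'.
rewrite /mutually_orthogonal /= !andbT; repeat (apply/andP; split); apply/eqP;
  by rewrite !dotpE !GC !GE; field; rewrite ?w10 ?w20 ?d0 ?d0'.
Qed.

(** * Solving the third- and fourth-order equations *)

Section HelixSolutions.
Context {R : realType} (gamma : R -> 'rV[R]_4) (gamma_smooth : smooth gamma).

Let g n : R -> 'rV[R]_4 := derive1n n gamma.
Let dg n (t : R) : is_derive t 1 (g n) (g n.+1 t).
Proof. exact: is_derive_derive1n. Qed.

(** The acceleration is a harmonic oscillator, and gamma + gamma'' / w^2 has zero derivative; its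
    constant value is the centre of the circle. *)
Lemma circle_solution (w t : R) : w != 0 ->
  (forall s, g 3 s = - (w ^+ 2 *: g 1 s)) ->
  gamma t = (g 0 0 + w ^- 2 *: g 2 0) + cos (w * t) *: (- (w ^- 2 *: g 2 0))
    + sin (w * t) *: (w^-1 *: g 1 0).
Proof.
move=> w0 ode; have g2E := @harmonic_row _ w (g 2) (g 3) t w0 (dg 2).
have {}g2E : g 2 t = cos (w * t) *: g 2 0 + sin (w * t) *: (w^-1 *: g 3 0).
  apply: g2E => s; rewrite (_ : g 3 = - w ^+ 2 \*: g 1); last first.
    by apply/funext => r; rewrite ode /= scaleNr.
  by apply: (is_derive_eq (is_deriveZ _ (dg 1 s))); rewrite scaleNr.
have cst : g 0 t + w ^- 2 *: g 2 t = g 0 0 + w ^- 2 *: g 2 0.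
  apply: (@is_derive_row0_cst _ (fun s => g 0 s + w ^- 2 *: g 2 s)) => s.
  apply: (is_derive_eq (is_deriveD (dg 0 s) (is_deriveZ _ (dg 2 s)))).
  by rewrite ode scalerN scalerA mulVf ?expf_neq0 // scale1r addrN.
rewrite -cst -[gamma t]/(g 0 t) g2E ode.
move: (g 0 t) (g 2 0) (g 1 0) => x y z.
by apply/rowP => i; rewrite !mxE; field.
Qed.

Lemma lissajous_solution (w1 w2 t : R) : w1 != 0 -> w2 != 0 ->
  w2 ^+ 2 - w1 ^+ 2 != 0 ->
  (forall s, g 4 s + (w1 ^+ 2 + w2 ^+ 2) *: g 2 s + (w1 ^+ 2 * w2 ^+ 2) *: g 0 s = 0) ->
  let d := (w2 ^+ 2 - w1 ^+ 2)^-1 in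
  gamma t = cos (w1 * t) *: (d *: (g 2 0 + w2 ^+ 2 *: g 0 0))
    + sin (w1 * t) *: ((d / w1) *: (g 3 0 + w2 ^+ 2 *: g 1 0))
    + cos (w2 * t) *: - (d *: (g 2 0 + w1 ^+ 2 *: g 0 0))
    + sin (w2 * t) *: - ((d / w2) *: (g 3 0 + w1 ^+ 2 *: g 1 0)).
Proof.
move=> w10 w20 d0 ode d.
(* Applying D^2 + w^2 to gamma leaves an oscillator of frequency v. The symmetric conditions on v
   and w allow the two frequencies to be taken in either order. *)
have factor (v w s : R) : v != 0 -> v ^+ 2 + w ^+ 2 = w1 ^+ 2 + w2 ^+ 2 ->
    v ^+ 2 * w ^+ 2 = w1 ^+ 2 * w2 ^+ 2 ->
    g 2 s + w ^+ 2 *: g 0 s = cos (v * s) *: (g 2 0 + w ^+ 2 *: g 0 0)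
      + sin (v * s) *: (v^-1 *: (g 3 0 + w ^+ 2 *: g 1 0)).
  move=> v0 vwD vwM.
  apply: (@harmonic_row _ v (fun s => g 2 s + w ^+ 2 *: g 0 s)
    (fun s => g 3 s + w ^+ 2 *: g 1 s)) => // r.
    exact: is_deriveD (dg 2 r) (is_deriveZ _ (dg 0 r)).
  apply: (is_derive_eq (is_deriveD (dg 3 r) (is_deriveZ _ (dg 1 r)))).
  apply/eqP; rewrite -subr_eq0 -(ode r) -vwD -vwM; apply/eqP.
  move: (g 4 r) (g 2 r) (g 0 r) => x y z.
  by apply/rowP => i; rewrite !mxE; ring.
have := factor w1 w2 t w10 erefl erefl.
have := factor w2 w1 t w20 (addrC _ _) (mulrC _ _).
rewrite -[gamma t]/(g 0 t).
move: (g 0 t) (g 2 t) (g 0 0) (g 1 0) (g 2 0) (g 3 0) => x y x0 x1 x2 x3 h1 h2.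
(* The difference of the two oscillators is (w2^2 - w1^2) gamma. *)
have -> : x = d *: ((y + w2 ^+ 2 *: x) - (y + w1 ^+ 2 *: x)).
  by apply/rowP => i; rewrite !mxE /d; field.
rewrite h1 h2; move: d => d.
by apply/rowP => i; rewrite !mxE; field; rewrite w10 w20.
Qed.

End HelixSolutions.

Theorem theorem1 (R : realType) (kappa tau : R)
    (hkappa : 0 <= kappa) (htau : 0 <= tau) (h0 : kappa = 0 -> tau = 0) :
  let w1 := omega1 kappa tau in
  let w2 := omega2 kappa tau in
  (exists gamma : R -> 'rV[R]_4, helix kappa tau gamma)
  /\
  (forall gamma : R -> 'rV[R]_4, helix kappa tau gamma ->
     [/\ (* (2)-(3) *)
         [/\ 0 <= w1, w1 < w2
           & exists A1 B1 A2 B2 : 'rV[R]_4, lissajous w1 w2 A1 B1 A2 B2 gamma],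
         (* (4) *)
         0 < kappa -> w1 < 1 /\ 1 < w2,
         (* (5) *)
         tau != 0 ->
           forall A1 B1 A2 B2 : 'rV[R]_4, lissajous w1 w2 A1 B1 A2 B2 gamma ->
             [/\ mutually_orthogonal [:: A1; B1; A2; B2],
                 enorm A1 ^+ 2 = (1 - w2 ^+ 2) / (w1 ^+ 2 - w2 ^+ 2),
                 enorm B1 ^+ 2 = (1 - w2 ^+ 2) / (w1 ^+ 2 - w2 ^+ 2),
                 enorm A2 ^+ 2 = (1 - w1 ^+ 2) / (w2 ^+ 2 - w1 ^+ 2)
               & enorm B2 ^+ 2 = (1 - w1 ^+ 2) / (w2 ^+ 2 - w1 ^+ 2)]
       & (* (6) *)
         tau = 0 ->
           let w := Num.sqrt (kappa ^+ 2 + 1) in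
           exists A1 A2 B2 : 'rV[R]_4,
             [/\ forall t, gamma t = A1 + cos (w * t) *: A2 + sin (w * t) *: B2,
                 mutually_orthogonal [:: A1; A2; B2],
                 enorm A2 = 1 / w, enorm B2 = 1 / w
               & enorm A1 = Num.sqrt (1 - 1 / w ^+ 2)]]).
Proof.
move=> w1 w2.
have w1_ge0 : 0 <= w1 by exact: omega1_ge0.
have w12 : w1 < w2 by exact: omega_lt.
have w2_gt0 : 0 < w2 by exact: omega2_gt0.
have w12_sqr : w1 ^+ 2 < w2 ^+ 2 by exact: omega_sqr_lt.
have wM : w1 ^+ 2 * w2 ^+ 2 = tau ^+ 2 by exact: omega_sqrM.
have wD : w1 ^+ 2 + w2 ^+ 2 = chi2 kappa tau by exact: omega_sqrD.
have wK : (1 - w1 ^+ 2) * (w2 ^+ 2 - 1) = kappa ^+ 2 by exact: omega_kappa.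
have w_straddle1 := omega_straddle1 h0.
have w1_tau0 : tau = 0 -> w1 = 0 by exact: omega1_tau0.
have w2_tau0 : tau = 0 -> w2 = Num.sqrt (kappa ^+ 2 + 1) by exact: omega2_tau0.
have w1_neq0 : tau != 0 -> w1 != 0 by exact: omega1_neq0.
have w_lt1 : 0 < kappa -> w1 < 1 /\ 1 < w2 by exact: omega_straddle1_strict.
rewrite -/w1 -/w2 in w_straddle1; clearbody w1 w2.
have w2_neq0 : w2 != 0 by rewrite gt_eqF.
have d_neq0 : w2 ^+ 2 - w1 ^+ 2 != 0 by rewrite subr_eq0 gt_eqF.
split; first exact: (@lissajous_helix _ _ _ w1 w2).
move=> gamma [[gS3 gsm gunit _ _] gcurv gtors].
have G00 := dotp_position gS3 0.
have G01 := dotp_position_velocity gS3 gsm 0.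
have G02 := dotp_position_acceleration gS3 gsm gunit 0.
have G03 := dotp_position_jerk gS3 gsm gunit 0.
have G11 := dotp_velocity gunit 0.
have G12 := dotp_velocity_acceleration gsm gunit 0.
have G13 := dotp_velocity_jerk gS3 gsm gunit gcurv 0.
have G22 := dotp_acceleration gS3 gsm gunit gcurv 0.
have G23 := dotp_acceleration_jerk gS3 gsm gunit gcurv 0.
have G33 := dotp_jerk gS3 gsm gunit gcurv gtors 0.
(* For tau = 0 the frequency of the circle is w2, so the same vectors serve for the Lissajous form
   and for the circle. *)
have circle : tau = 0 -> forall t, gamma t =
    (derive1n 0 gamma 0 + w2 ^- 2 *: derive1n 2 gamma 0)
    + cos (w2 * t) *: (- (w2 ^- 2 *: derive1n 2 gamma 0))
    + sin (w2 * t) *: (w2^-1 *: derive1n 1 gamma 0).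
  move=> t0 t; apply: circle_solution => // s.
  rewrite (helix_ode3 gS3 gsm gunit gcurv gtors s t0).
  by rewrite w2_tau0 // sqr_sqrtr // addr_ge0 // sqr_ge0.
split.
- split=> //; have [t0|t0] := eqVneq tau 0.
    (* Since w1 = 0, the first cosine is 1 and carries the centre, and the first sine vanishes, so 0
       serves as its coefficient. *)
    exists (derive1n 0 gamma 0 + w2 ^- 2 *: derive1n 2 gamma 0), 0,
      (- (w2 ^- 2 *: derive1n 2 gamma 0)), (w2^-1 *: derive1n 1 gamma 0) => t.
    by rewrite circle // w1_tau0 // mul0r cos0 sin0 scale1r scale0r addr0.
  do 4!eexists; move=> t; apply: lissajous_solution => // [|s]; first exact: w1_neq0.
  by rewrite wD wM; exact: helix_ode4.
- by [].
- move=> t0 A1 B1 A2 B2 gE.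
  have {}gE : gamma = lissajous_curve w1 w2 A1 B1 A2 B2.
    by apply/funext => t; rewrite gE.
  (* Differentiating the given representation up to order three and evaluating at 0 covers every
     choice of coefficient vectors. *)
  have := congr1 (@derive1 R _) gE; rewrite derive1_lissajous_curve -derive1n1 => g1E.
  have := congr1 (@derive1 R _) g1E; rewrite derive1_lissajous_curve -derive1nS => g2E.
  have := congr1 (@derive1 R _) g2E; rewrite derive1_lissajous_curve -derive1nS => g3E.
  rewrite exprMn in G33.
  apply: (lissajous_coefficients (w1_neq0 t0) w2_neq0 d_neq0 wM wK
    G00 G01 G02 G03 G11 G12 G13 G22 G23 G33).
  + by rewrite derive1n0 gE lissajous_curve0.
  + by rewrite g1E lissajous_curve0.
  + by rewrite g2E lissajous_curve0; apply/rowP => i; rewrite !mxE; ring.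
  + by rewrite g3E lissajous_curve0; apply/rowP => i; rewrite !mxE; ring.
- move=> t0 w; rewrite {}/w -w2_tau0 //.
  have k2 : kappa ^+ 2 + 1 = w2 ^+ 2.
    by rewrite w2_tau0 // sqr_sqrtr // addr_ge0 // sqr_ge0.
  do 3!eexists; split; first exact: circle.
  all: move: (derive1n 0 gamma 0) (derive1n 1 gamma 0) (derive1n 2 gamma 0)
    G00 G01 G02 G11 G12 G22 => X0 X1 X2 G00 G01 G02 G11 G12 {}G22.
  all: have GE := (dotpC X2 X0, dotpC X2 X1, dotpC X1 X0,
    G00, G01, G02, G11, G12, G22, k2).
  + by rewrite /mutually_orthogonal /= !andbT; repeat (apply/andP; split);
      apply/eqP; rewrite !dotpE !GE; field.
  + apply/enorm_eqP; first by rewrite divr_ge0 // ltW.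
    by rewrite !dotpE !GE; field.
  + apply/enorm_eqP; first by rewrite divr_ge0 // ltW.
    by rewrite !dotpE !GE; field.
  (* The squared length of the centre is 1 - 2 / w2^2 + (kappa^2 + 1) / w2^4, where kappa^2 + 1 =
     w2^2. *)
  + by rewrite /enorm !dotpE !GE; congr Num.sqrt; field.
Qed.
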